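(* (Generalized Collage Theorem) Let $(X,\delta)$ be a dislocated metric space and let $(X;f_1,\dots,f_N;g_1,\dots,g_N)$ be a generalized iterated function system. Suppose that the pair $(T,S)$ of self-mappings of $\mathcal{C}(X)$ defined by $$T(B)=f_1(B)\cup\cdots\cup f_N(B),\qquad S(B)=g_1(B)\cup\cdots\cup g_N(B)\qquad(B\in\mathcal{C}(X))$$ satisfies $H_\delta(T(A),S(B))\le\alpha H_\delta(A,B)$ for all $A,B\in\mathcal{C}(X)$, where $0\le\alpha<1$. Let $U\in\mathcal{C}(X)$ be the common attractor of $T$ and $S$, that is, $U=T(U)=S(U)$. If $A\in\mathcal{C}(X)$ and $\varepsilon\ge 0$ are such that either $H_\delta(A,T(A))\le\varepsilon$ or $H_\delta(A,S(A))\le\varepsilon$, then $$H_\delta(A,U)\le\frac{\varepsilon}{1-\alpha}.$$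
   Context: A dislocated metric on a nonempty set $X$ is a function $\delta:X\times X\to[0,\infty)$ such that for all $x,y,z\in X$: (1) $\delta(x,y)=0$ implies $x=y$; (2) $\delta(x,y)=\delta(y,x)$; (3) $\delta(x,z)\le\delta(x,y)+\delta(y,z)$. (Self-distances $\delta(x,x)$ may be nonzero.) The pair $(X,\delta)$ is a dislocated metric space. For $\varepsilon>0$ the ball is $B_\varepsilon(x)=\{y\in X:|\delta(x,y)-\delta(x,x)|<\varepsilon\}$. A set $U\subseteq X$ is open (belongs to $\tau_\delta$) if for every $u\in U$ there is $\varepsilon>0$ with $B_\varepsilon(u)\subseteq U$. A subset $K$ of $X$ is compact if every cover of $K$ by open sets has a finite subcover. $\mathcal{C}(X)$ is the family of nonempty compact subsets of $X$. For sets $R,S$ and $x\in X$: $\delta(x,R)=\inf\{\delta(x,r):r\in R\}$, $\sigma_\delta(R,S)=\sup\{\delta(r,S):r\in R\}$, and the dislocated Hausdorff metric is $H_\delta(R,S)=\max\{\sigma_\delta(R,S),\sigma_\delta(S,R)\}$; these formulas are used for sets in $\mathcal{C}(X)$. A pair $(f,g)$ of maps $X\to X$ is a generalized contraction if there is $\alpha\in[0,1)$ with $\delta(fx,gy)\le\alpha\,\delta(x,y)$ for all $x,y\in X$. A generalized iterated function system $(X;f_1,\dots,f_N;g_1,\dots,g_N)$ consists of maps $f_n,g_n:X\to X$, $n=1,\dots,N$, such that each pair $(f_n,g_n)$ is a generalized contraction.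
   Formalization: The formal theorem takes H_δ with values in [0,∞] and additionally assumes that H_δ(A,U) is finite; compact sets here can be δ-unbounded, and the claimed inequality fails when H_δ(A,U) is infinite. *)

(* Defs.v *)
From HB Require Import structures.
From mathcomp Require Import all_boot all_order all_algebra.
From mathcomp Require Import boolp classical_sets reals constructive_ereal ereal.
From mathcomp Require Import topology.

Set Implicit Arguments.
Unset Strict Implicit.
Unset Printing Implicit Defensive.

Import Order.TTheory GRing.Theory Num.Theory.

Local Open Scope classical_set_scope.
Local Open Scope ring_scope.

Record dislocated_metric (R : realType) (X : Type) (delta : X -> X -> R) : Prop := {
  dm_nonempty : [set: X] !=set0 ;
  dm_ge0 : forall x y, 0 <= delta x y ;
  dm_eq : forall x y, delta x y = 0 -> x = y ;
  dm_sym : forall x y, delta x y = delta y x ;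
  dm_triangle : forall x y z, delta x z <= delta x y + delta y z
}.

Definition dball (R : realType) (X : Type) (delta : X -> X -> R) (x : X) (e : R) : set X :=
  [set y | `|delta x y - delta x x| < e].

Definition dopen (R : realType) (X : Type) (delta : X -> X -> R) (U : set X) : Prop :=
  forall u, U u -> exists2 e : R, 0 < e & dball delta u e `<=` U.

(* The carrier X equipped with the topology tau_delta, whose open sets are
   exactly the [dopen] ones (see [open_dspaceE]); balls need not be open. *)
Definition dspace (R : realType) (X : Type) (delta : X -> X -> R) : Type := X.

Section DspaceTopology.
Variables (R : realType) (X : Type) (delta : X -> X -> R).

Lemma dopenT : dopen delta setT.
Proof. by move=> u _; exists 1. Qed.

Lemma dopenI : setI_closed (dopen delta).
Proof.
move=> A B oA oB u [Au Bu].
have [a a0 aA] := oA u Au; have [b b0 bB] := oB u Bu.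
exists (Num.min a b); first by rewrite lt_min a0.
by move=> y; rewrite /dball /= lt_min => /andP[ya yb]; split; [exact: aA|exact: bB].
Qed.

Lemma dopen_bigU (I : Type) (F : I -> set X) :
  (forall i, dopen delta (F i)) -> dopen delta (\bigcup_i F i).
Proof.
move=> oF u [i _ Fiu]; have [e e0 eF] := oF i u Fiu.
by exists e => // y /eF Fiy; exists i.
Qed.

HB.instance Definition _ := gen_eqMixin (dspace delta).
HB.instance Definition _ := gen_choiceMixin (dspace delta).
HB.instance Definition _ :=
  isOpenTopological.Build (dspace delta) dopenT dopenI dopen_bigU.

Lemma open_dspaceE : (@open (dspace delta)) = dopen delta.
Proof. by []. Qed.

End DspaceTopology.

(* The family C(X) of nonempty compact subsets of X. *)
Definition hyperspace (R : realType) (X : Type) (delta : X -> X -> R) : set (set X) :=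
  [set K | K !=set0 /\ cover_compact (K : set (dspace delta))].

(* Infima and suprema are taken in the extended reals: since balls need not be
   open, a compact set need not be delta-bounded, and H_delta may be +oo. *)
Definition dist_set (R : realType) (X : Type) (delta : X -> X -> R)
    (x : X) (S : set X) : \bar R :=
  ereal_inf [set (delta x s)%:E | s in S].

Definition hausdorff_excess (R : realType) (X : Type) (delta : X -> X -> R)
    (A B : set X) : \bar R :=
  ereal_sup [set dist_set delta a B | a in A].

Definition dhausdorff (R : realType) (X : Type) (delta : X -> X -> R)
    (A B : set X) : \bar R :=
  maxe (hausdorff_excess delta A B) (hausdorff_excess delta B A).

Definition generalized_contraction (R : realType) (X : Type) (delta : X -> X -> R)
    (f g : X -> X) : Prop :=
  exists2 a : R, 0 <= a < 1 & forall x y, delta (f x) (g y) <= a * delta x y.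

Definition generalized_ifs (R : realType) (X : Type) (delta : X -> X -> R)
    (N : nat) (f g : 'I_N -> X -> X) : Prop :=
  (0 < N)%N /\ forall n, generalized_contraction delta (f n) (g n).

Definition ifs_map (X : Type) (N : nat) (f : 'I_N -> X -> X) (B : set X) : set X :=
  \bigcup_n (f n @` B).

(* Main.v *)
(** In the extended reals, [H_delta] is symmetric and satisfies the triangle
    inequality through a nonempty set. Since [U = S(U)], this gives
    [H(A,U) <= H(A,T(A)) + H(T(A),S(U)) <= eps + alpha * H(A,U)], which can be
    solved for [H(A,U)] when the latter is finite; if the second alternative
    holds, [T] and [S] exchange roles. *)

Require Import Defs.
From mathcomp Require Import all_boot all_order all_algebra.
From mathcomp Require Import boolp classical_sets reals constructive_ereal ereal.
From mathcomp Require Import topology.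

Import Order.TTheory GRing.Theory Num.Theory.

Local Open Scope classical_set_scope.
Local Open Scope ring_scope.
Local Open Scope ereal_scope.

Lemma dist_set_ge0 {R : realType} {X : Type} {delta : X -> X -> R} :
  dislocated_metric delta -> forall x (B : set X), 0 <= dist_set delta x B.
Proof.
by move=> hd x B; apply: le_ereal_inf_tmp => _ [b _ <-]; rewrite lee_fin dm_ge0.
Qed.

(** Nonemptiness of [A] matters: a supremum over the empty set is [-oo]. *)
Lemma hausdorff_excess_ge0 {R : realType} {X : Type} {delta : X -> X -> R} :
  dislocated_metric delta ->
  forall A B : set X, A !=set0 -> 0 <= hausdorff_excess delta A B.
Proof.
move=> hd A B [a Aa]; apply: (le_trans (dist_set_ge0 hd a B)).
by apply: ereal_sup_ubound; exists a.
Qed.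

(** Take infima in the pointwise inequality through some [b] in [B], first over [C] and then over
    [B]; between the two, the distance from [b] to [C] is bounded by the excess, which does not
    depend on [b]. *)
Lemma dist_set_triangle {R : realType} {X : Type} {delta : X -> X -> R} :
  dislocated_metric delta -> forall x (B C : set X), B !=set0 ->
  dist_set delta x C <= dist_set delta x B + hausdorff_excess delta B C.
Proof.
move=> hd x B C B0.
have := hausdorff_excess_ge0 hd _ C B0.
(* A finite excess can be moved across the inequality. If it is [+oo], so is the right-hand side,
   the other summand being nonnegative. *)
case E: (hausdorff_excess delta B C) => [r| |] // _; last first.
  by rewrite addey ?leey // gt_eqF // (lt_le_trans ltNy0) ?dist_set_ge0.
rewrite -leeBlDr //; apply: le_ereal_inf_tmp => _ [b Bb <-].
rewrite leeBlDr // -E.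
apply: (@le_trans _ _ ((delta x b)%:E + dist_set delta b C)); last first.
  by apply: leeD2l; apply: ereal_sup_ubound; exists b.
rewrite -leeBlDl //; apply: le_ereal_inf_tmp => _ [c Cc <-].
rewrite leeBlDl // (@le_trans _ _ (delta x c)%:E) //.
  by apply: ereal_inf_lbound; exists c.
by rewrite -EFinD lee_fin dm_triangle.
Qed.

Lemma hausdorff_excess_triangle {R : realType} {X : Type}
    {delta : X -> X -> R} :
  dislocated_metric delta -> forall A B C : set X, B !=set0 ->
  hausdorff_excess delta A C
    <= hausdorff_excess delta A B + hausdorff_excess delta B C.
Proof.
move=> hd A B C B0; apply: ge_ereal_sup => _ [a Aa <-].
apply: (le_trans (dist_set_triangle hd a _ C B0)).
by apply: leeD2r; apply: ereal_sup_ubound; exists a.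
Qed.

Lemma dhausdorffC (R : realType) (X : Type) (delta : X -> X -> R)
    (A B : set X) :
  dhausdorff delta A B = dhausdorff delta B A.
Proof. by rewrite /dhausdorff maxC. Qed.

Lemma dhausdorff_ge0 {R : realType} {X : Type} {delta : X -> X -> R} :
  dislocated_metric delta ->
  forall A B : set X, A !=set0 -> 0 <= dhausdorff delta A B.
Proof.
by move=> hd A B A0; rewrite /dhausdorff le_max hausdorff_excess_ge0.
Qed.

Lemma dhausdorff_triangle {R : realType} {X : Type} {delta : X -> X -> R} :
  dislocated_metric delta -> forall A B C : set X, B !=set0 ->
  dhausdorff delta A C <= dhausdorff delta A B + dhausdorff delta B C.
Proof.
move=> hd A B C B0; rewrite {1}/dhausdorff ge_max; apply/andP; split.
  apply: (le_trans (hausdorff_excess_triangle hd A _ C B0)).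
  by apply: leeD; rewrite /dhausdorff le_max lexx.
(* The reverse excess passes through [B] from [C] to [A], so its two summands come in the opposite
   order. *)
apply: (le_trans (hausdorff_excess_triangle hd C _ A B0)).
by rewrite addeC; apply: leeD; rewrite /dhausdorff le_max lexx orbT.
Qed.

Theorem theorem3p5 (R : realType) (X : Type) (delta : X -> X -> R)
    (hdelta : dislocated_metric delta)
    (N : nat) (f g : 'I_N -> X -> X)
    (hfg : generalized_ifs delta f g)
    (hT : forall B, hyperspace delta B -> hyperspace delta (ifs_map f B))
    (hS : forall B, hyperspace delta B -> hyperspace delta (ifs_map g B))
    (alpha : R) (halpha : (0 <= alpha < 1)%R)
    (hTS : forall A B, hyperspace delta A -> hyperspace delta B ->
       dhausdorff delta (ifs_map f A) (ifs_map g B)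
         <= alpha%:E * dhausdorff delta A B)
    (U : set X) (hU : hyperspace delta U)
    (hUT : U = ifs_map f U) (hUS : U = ifs_map g U)
    (A : set X) (hA : hyperspace delta A)
    (hfin : dhausdorff delta A U < +oo)
    (eps : R) (heps : (0 <= eps)%R)
    (hcollage : dhausdorff delta A (ifs_map f A) <= eps%:E \/
                dhausdorff delta A (ifs_map g A) <= eps%:E) :
  dhausdorff delta A U <= (eps / (1 - alpha))%:E.
Proof.
(* [B] stands for either image of [A], so both alternatives share one computation. *)
have key B : B !=set0 -> dhausdorff delta A B <= eps%:E ->
    dhausdorff delta B U <= alpha%:E * dhausdorff delta A U ->
    dhausdorff delta A U <= (eps / (1 - alpha))%:E.
  move=> B0 hAB hBU.
  have := le_trans (dhausdorff_triangle hdelta A _ U B0) (leeD hAB hBU).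
  have := dhausdorff_ge0 hdelta _ U hA.1.
  (* Finiteness and nonnegativity leave only a real value [h], with [h <= eps + alpha * h]. *)
  case: (dhausdorff delta A U) hfin => [h| |] // _ _.
  rewrite -EFinM -EFinD !lee_fin => hle.
  case/andP: halpha => _ alpha1.
  by rewrite ler_pdivlMr ?subr_gt0 // mulrBr mulr1 lerBlDr [(h * _)%R]mulrC.
case: hcollage => hc; apply: key hc _.
- exact: (hT _ hA).1.
- by rewrite {1}hUS; exact: hTS.
- exact: (hS _ hA).1.
(* The contraction hypothesis has the [f]-image on the left, so symmetry is applied on both sides to
   use it for the pair [U], [A]. *)
- by rewrite dhausdorffC {1}hUT [X in _ <= _ * X]dhausdorffC; exact: hTS.
Qed.
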